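(* $A(\lambda)=a\lambda+Y$, with $Y\in gl(n,\mathbb C)$ constant in $\lambda$, satisfies the $GD_n$-reality condition if and only if $$Y=b+\sum_{i=0}^{n-1}y_if_i$$ for some $y_0,\dots,y_{n-1}\in\mathbb C$.
   Context: Let $\alpha=e^{2\pi i/n}$, $a=\mathrm{diag}(1,\alpha,\dots,\alpha^{n-1})$, $e_{ij}$ the matrix units, $b=e_{21}+e_{32}+\dots+e_{n,n-1}$. Let $V(\lambda)$ be the $n\times n$ matrix with $(i,j)$ entry $(\alpha^{i-1}\lambda)^{j-1}$. Then $V(\lambda)=\phi_n^-(\lambda)\phi_n(\lambda)$ uniquely, with $\phi_n^-$ lower triangular and $\phi_n$ upper triangular with $1$'s on the diagonal, and $\phi_n(\lambda)=I+f_1\lambda+\dots+f_{n-1}\lambda^{n-1}$ with constant strictly upper triangular matrices $f_i$; put $f_0=I$. (Each $f_i$, $i\ge1$, is a nonzero scalar multiple of $\Lambda^i$, where $\Lambda=\sum_{i=1}^{n-1}(1+\alpha+\dots+\alpha^{i-1})e_{i,i+1}$.) $A(\lambda)$ satisfies the $GD_n$-reality condition if $$\phi_n(\lambda)^{-1}A(\lambda)\phi_n(\lambda)=\phi_n(\alpha\lambda)^{-1}A(\alpha\lambda)\phi_n(\alpha\lambda)\quad\text{for all }\lambda.$$ *)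

(* Defs.v *)
From HB Require Import structures.
From mathcomp Require Import all_boot all_order all_algebra.
From mathcomp Require Import complex.
From mathcomp Require Import boolp classical_sets reals trigo.

Set Implicit Arguments.
Unset Strict Implicit.
Unset Printing Implicit Defensive.

Import Order.TTheory GRing.Theory Num.Theory.
Local Open Scope ring_scope.
Local Open Scope complex_scope.

(* The complex field is R[i] for R : realType, and gl(n, C) is 'M[R[i]]_n.
   Rows and columns are numbered from 0, so that, e.g., the matrix unit
   e_{i+1,j+1} is delta_mx i j. *)

(* e^{2 pi i / n} *)
Definition GD_alpha (R : realType) (n : nat) : R[i] :=
  cos (2 * pi / n%:R) +i* sin (2 * pi / n%:R).

Definition GD_a (R : realType) (n : nat) : 'M[R[i]]_n :=
  diag_mx (\row_(i < n) GD_alpha R n ^+ i).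

(* e_{21} + e_{32} + ... + e_{n,n-1} *)
Definition GD_b (R : realType) (n : nat) : 'M[R[i]]_n :=
  \matrix_(i < n, j < n) (i == j.+1 :> nat)%:R.

Definition GD_V (R : realType) (n : nat) (lambda : R[i]) : 'M[R[i]]_n :=
  \matrix_(i < n, j < n) (GD_alpha R n ^+ i * lambda) ^+ j.

Definition mx_pencil (R : realType) (n : nat) (f : 'I_n -> 'M[R[i]]_n)
    (lambda : R[i]) : 'M[R[i]]_n :=
  \sum_(i < n) lambda ^+ i *: f i.

Definition unit_upper_trig (R : realType) (n : nat) (U : 'M[R[i]]_n) : Prop :=
  is_trig_mx U^T /\ forall i, U i i = 1.

(* V(lambda) = phi^-(lambda) phi(lambda), with phi^- lower triangular, phi
   upper triangular with 1's on the diagonal, and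
   phi(lambda) = I + f_1 lambda + ... + f_{n-1} lambda^{n-1}.
   The polynomial form of phi is what makes phi(0) unique, as V(0) is singular
   for n >= 2; the f_i, i >= 1, are then strictly upper triangular because
   phi(lambda) is unit upper triangular for all lambda. *)
Definition GD_factorization (R : realType) (n : nat)
    (f : 'I_n -> 'M[R[i]]_n) : Prop :=
  (forall i : 'I_n, i = 0%N :> nat -> f i = 1%:M) /\
  exists phim : R[i] -> 'M[R[i]]_n, forall lambda,
    [/\ is_trig_mx (phim lambda),
        unit_upper_trig (mx_pencil f lambda) &
        GD_V n lambda = phim lambda *m mx_pencil f lambda].

(* The unique f such that GD_factorization f; the default value 0 of xget is
   irrelevant since such an f exists. *)
Definition GD_f (R : realType) (n : nat) : 'I_n -> 'M[R[i]]_n :=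
  xget (fun=> 0) [set f : 'I_n -> 'M[R[i]]_n | GD_factorization f]%classic.

Definition GD_phi (R : realType) (n : nat) (lambda : R[i]) : 'M[R[i]]_n :=
  mx_pencil (@GD_f R n) lambda.

Definition GD_reality (R : realType) (n : nat)
    (A : R[i] -> 'M[R[i]]_n) : Prop :=
  forall lambda : R[i],
    invmx (GD_phi n lambda) *m A lambda *m GD_phi n lambda =
    invmx (GD_phi n (GD_alpha R n * lambda)) *m A (GD_alpha R n * lambda)
      *m GD_phi n (GD_alpha R n * lambda).

(* Main.v *)
Require Import Defs.
From mathcomp Require Import all_boot all_order all_algebra.
From mathcomp Require Import complex.
From mathcomp Require Import reals.
From mathcomp Require Import boolp classical_sets trigo ring.

Import Order.TTheory GRing.Theory Num.Theory.
Local Open Scope ring_scope.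
Local Open Scope complex_scope.

(** Everything is explicit in terms of Gaussian binomials at q = alpha.
    Numbering from 0, phi(lambda) has entries [j choose i]_q lambda ^ (j - i), because the
    power x ^ j expands in the Newton basis prod_(l < k) (x - q ^ l) with the
    coefficients [j choose k]_q; f_k is the k-th superdiagonal of phi(1).
    This is [vandermonde_LU], and uniqueness of the factorization turns the
    chosen f into these superdiagonals ([GD_fE]).

    Let T be the superdiagonal matrix with T_(i, i+1) = 1 - q ^ (i+1), that is,
    T = (1 - q) Lambda.  As phi(lambda) is a q-exponential of lambda Lambda, it
    solves the q-difference equation
      phi(q lambda) = (1 - lambda T) phi(lambda)        ([gauss_mx_scale]),
    so that all of phi except the factor M(lambda) = 1 - lambda T cancels from
    the reality condition, which becomes
      A(q lambda) M(lambda) = M(lambda) A(lambda) ([GD_reality_intertwine]).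

    The pencil a lambda + b satisfies it, by T a = q a T and
    T b - b T = (1 - q) a ([qderiv_mx_pencil]).  Subtracting, Y satisfies it iff
    Z = Y - b commutes with T.  Finally the f_k commute with T, and a matrix
    commuting with T is determined by its row 0, where f_k is the k-th basis
    vector; hence the commutant of T is the span of the f_k
    ([qderiv_mx_commutant]). *)

(** * Gaussian binomials *)

Fixpoint gauss_binom {R : comNzRingType} (q : R) (m k : nat) : R :=
  match m, k with
  | _, 0%N => 1
  | 0%N, _.+1 => 0
  | m'.+1, k'.+1 =>
      gauss_binom q m' k' + q ^+ k'.+1 * gauss_binom q m' k'.+1
  end.

Lemma gauss_binom0 {R : comNzRingType} (q : R) (m : nat) :
  gauss_binom q m 0 = 1.
Proof. by case: m. Qed.

Lemma gauss_binomS {R : comNzRingType} (q : R) (m k : nat) :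
  gauss_binom q m.+1 k.+1 =
  gauss_binom q m k + q ^+ k.+1 * gauss_binom q m k.+1.
Proof. by []. Qed.

Lemma gauss_binom_small {R : comNzRingType} (q : R) (m k : nat) :
  (m < k)%N -> gauss_binom q m k = 0.
Proof.
elim: m k => [|m IHm] [|k] //; rewrite ltnS => lt_mk.
by rewrite gauss_binomS !IHm ?mulr0 ?addr0 // ltnS ltnW.
Qed.

Lemma gauss_binomnn {R : comNzRingType} (q : R) (m : nat) :
  gauss_binom q m m = 1.
Proof.
elim: m => // m IHm.
by rewrite gauss_binomS IHm gauss_binom_small // mulr0 addr0.
Qed.

(** The ratio of two consecutive Gaussian binomials in a row, free of
    denominators; for k >= m both sides vanish. *)
Lemma gauss_binom_step {R : comNzRingType} (q : R) (m k : nat) :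
  (1 - q ^+ k.+1) * gauss_binom q m k.+1 =
  (1 - q ^+ (m - k)) * gauss_binom q m k.
Proof.
elim: m k => [|m IHm] [|k].
- by rewrite /= mulr0 expr0 subrr mul0r.
- by rewrite /= !mulr0.
- have := IHm 0%N; rewrite gauss_binomS !gauss_binom0 !subn0 expr1 => H.
  by rewrite mulrDr mulrCA H !exprS; ring.
rewrite subSS.
have [le_mk|lt_km] := leqP m k.
  rewrite (gauss_binom_small q m.+1 k.+2) // mulr0.
  by have /eqP-> : (m - k == 0)%N by [] ; rewrite expr0 subrr mul0r.
have E1 := IHm k; have E2 := IHm k.+1.
rewrite !gauss_binomS mulrDr mulrCA E2 mulrDr.
rewrite -E1.
have -> : (m - k = (m - k.+1).+1)%N by rewrite subnS prednK // subn_gt0.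
by rewrite !exprS; ring.
Qed.

(** The q-analogue of k C(m, k) = m C(m-1, k-1). *)
Lemma gauss_binom_absorb {R : comNzRingType} (q : R) (m k : nat) :
  (1 - q ^+ k.+1) * gauss_binom q m.+1 k.+1 =
  (1 - q ^+ m.+1) * gauss_binom q m k.
Proof.
have [lt_mk|le_km] := ltnP m k.
  by rewrite !gauss_binom_small ?mulr0.
rewrite gauss_binomS mulrDr mulrCA gauss_binom_step.
have -> : q ^+ m.+1 = q ^+ (m - k) * q ^+ k.+1 by rewrite -exprD addnS subnK.
ring.
Qed.

(** The Newton basis at the nodes 1, q, q ^ 2, ... *)
Definition newton {R : comNzRingType} (q : R) (k : nat) (x : R) : R :=
  \prod_(l < k) (x - q ^+ l).

(** Induction on m: multiplying by x acts on the Newton basis by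
    x N_k = N_(k+1) + q ^ k N_k, which is the Pascal rule on coefficients. *)
Lemma expr_newton {R : comNzRingType} (q x : R) (m : nat) :
  x ^+ m = \sum_(k < m.+1) newton q k x * gauss_binom q m k.
Proof.
elim: m => [|m IHm].
  by rewrite big_ord1 /newton big_ord0 mul1r.
pose g k := newton q k x * (q ^+ k * gauss_binom q m k).
have newtonS k : newton q k.+1 x = newton q k x * (x - q ^+ k).
  by rewrite /newton big_ord_recr.
have sum_g : newton q 0 x + \sum_(k < m.+1) g k.+1 = \sum_(k < m.+1) g k.
  have -> : newton q 0 x = g 0%N by rewrite /g expr0 gauss_binom0 !mulr1.
  rewrite -(big_ord_recl m.+1 (fun k => g (nat_of_ord k))).
  by rewrite big_ord_recr /= {2}/g gauss_binom_small // !mulr0 addr0.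
rewrite big_ord_recl gauss_binom0 mulr1.
under eq_bigr => k _ do rewrite lift0 gauss_binomS mulrDr -/(g k.+1).
rewrite big_split addrCA sum_g -big_split exprS IHm mulr_sumr.
by apply: eq_bigr => k _; rewrite /= newtonS /g; ring.
Qed.

(** * The matrix of the q-derivative and its commutant *)

(** The matrix, in the monomial basis, of x ^ j |-> (1 - q ^ j) x ^ (j-1), which
    is (1 - q) times the q-derivative; in the notation of the statement it is
    (1 - alpha) Lambda. *)
Definition qderiv_mx {R : comNzRingType} (q : R) (n : nat) : 'M[R]_n :=
  \matrix_(i < n, j < n) ((j == i.+1 :> nat)%:R * (1 - q ^+ j)).

(** The explicit form of f_k. *)
Definition gauss_diag {R : comNzRingType} (q : R) (n : nat) (k : 'I_n) :
    'M[R]_n :=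
  \matrix_(i < n, j < n) ((j == i + k :> nat)%N%:R * gauss_binom q j i).

(** The explicit form of phi(x). *)
Definition gauss_mx {R : comNzRingType} (q : R) (n : nat) (x : R) : 'M[R]_n :=
  \matrix_(i < n, j < n) (gauss_binom q j i * x ^+ (j - i)).

(** The entries are given by a function on all naturals so that the last row
    needs no separate case: there the factor 1 - q ^ n vanishes. *)
Lemma mul_qderiv_mx {R : comNzRingType} (q : R) (n : nat)
    (g : nat -> nat -> R) :
  q ^+ n = 1 ->
  qderiv_mx q n *m (\matrix_(i < n, j < n) g i j) =
  \matrix_(i < n, j < n) ((1 - q ^+ i.+1) * g i.+1 j).
Proof.
move=> qn1; apply/matrixP => i j; rewrite !mxE.
have [lt_in|] := ltnP i.+1 n.
  rewrite (bigD1 (Ordinal lt_in)) //= !mxE /= eqxx mul1r big1 ?addr0 // => k.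
  by rewrite -val_eqE /= !mxE => /negPf->; rewrite !mul0r.
move=> le_ni; have -> : i.+1 = n by apply/eqP; rewrite eqn_leq le_ni ltn_ord.
rewrite qn1 subrr mul0r big1 // => k _; rewrite !mxE.
case: eqP => [Eki|]; last by rewrite !mul0r.
by move: (ltn_ord k); rewrite Eki ltnNge le_ni.
Qed.

(** In column 0 the factor 1 - q ^ 0 vanishes, so the junk value 0.-1 = 0 is
    harmless. *)
Lemma mulr_qderiv_mx {R : comNzRingType} (q : R) (n : nat)
    (g : nat -> nat -> R) :
  (\matrix_(i < n, j < n) g i j) *m qderiv_mx q n =
  \matrix_(i < n, j < n) ((1 - q ^+ j) * g i j.-1).
Proof.
apply/matrixP => i j; rewrite !mxE.
case: j => [[|j] lt_jn] /=.
  by rewrite expr0 subrr mul0r big1 // => k _; rewrite !mxE /= mul0r mulr0.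
rewrite (bigD1 (Ordinal (ltnW lt_jn))) //= !mxE /= eqxx mul1r mulrC.
rewrite big1 ?addr0 // => k; rewrite -val_eqE /= !mxE /= eqSS eq_sym.
by move=> /negPf->; rewrite mul0r mulr0.
Qed.

(** The q-difference equation of the q-exponential. *)
Lemma gauss_mx_scale {R : comNzRingType} (q : R) (n : nat) (x : R) :
  q ^+ n = 1 ->
  gauss_mx q n (q * x) = (1%:M - x *: qderiv_mx q n) *m gauss_mx q n x.
Proof.
move=> qn1; rewrite mulmxBl mul1mx -scalemxAl.
rewrite (mul_qderiv_mx _ _ (fun i j => gauss_binom q j i * x ^+ (j - i))) //.
apply/matrixP => i j; rewrite !mxE [(1 - _) * (_ * _)]mulrA gauss_binom_step.
have [lt_ij|le_ji] := ltnP i j.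
  have -> : (j - i = (j - i.+1).+1)%N by rewrite subnS prednK // subn_gt0.
  rewrite exprMn.
  by rewrite !exprS; ring.
have /eqP-> : (j - i == 0)%N by []; rewrite !expr0; ring.
Qed.

Lemma gauss_diag_comm {R : comNzRingType} (q : R) (n : nat) (k : 'I_n) :
  q ^+ n = 1 ->
  qderiv_mx q n *m gauss_diag q n k = gauss_diag q n k *m qderiv_mx q n.
Proof.
move=> qn1.
pose g i j := (j == i + k)%N%:R * gauss_binom q j i.
rewrite (mul_qderiv_mx _ _ g) // (mulr_qderiv_mx _ _ g).
apply/matrixP => i j; rewrite !mxE /g.
case: j => [[|j] lt_jn] /=; first by rewrite expr0 subrr !mul0r mulr0.
by rewrite eqSS !(mulrCA (1 - _)) gauss_binom_absorb.
Qed.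

(** The (i, j) entry of T X = X T reads
    (1 - q ^ (i+1)) X_(i+1, j) = (X T)_(i, j), where the left factor is nonzero
    by primitivity of q; so row i determines row i+1. *)
Lemma qderiv_mx_comm_row0 {R : idomainType} (q : R) (n : nat) (X : 'M[R]_n) :
  n.-primitive_root q -> qderiv_mx q n *m X = X *m qderiv_mx q n ->
  (forall i j : 'I_n, i = 0%N :> nat -> X i j = 0) -> X = 0.
Proof.
move=> q_prim comX X0; apply/matrixP => i.
case: i; elim=> [|i IHi] lt_in j; rewrite mxE; first exact: X0.
have := congr1 (fun M : 'M_n => M (Ordinal (ltnW lt_in)) j) comX.
rewrite !mxE (bigD1 (Ordinal lt_in)) //= big1 => [|k]; last first.
  by rewrite -val_eqE /= !mxE => /negPf->; rewrite !mul0r.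
rewrite big1 => [|k _]; last by rewrite IHi !mxE mul0r.
rewrite !mxE /= eqxx mul1r addr0 => /eqP; rewrite mulf_eq0 => /orP[|/eqP//].
rewrite subr_eq0 eq_sym -(expr0 q) (eq_prim_root_expr q_prim).
by rewrite mod0n modn_small.
Qed.

(** T is a regular nilpotent matrix, so its commutant has dimension n; the
    coefficients of Z are read off its row 0. *)
Lemma qderiv_mx_commutant {R : idomainType} (q : R) (n : nat) (Z : 'M[R]_n) :
  n.-primitive_root q ->
  qderiv_mx q n *m Z = Z *m qderiv_mx q n <->
  exists y : 'I_n -> R, Z = \sum_(k < n) y k *: gauss_diag q n k.
Proof.
move=> q_prim; have qn1 := prim_expr_order q_prim.
have n_gt0 := prim_order_gt0 q_prim.
have com y : qderiv_mx q n *m (\sum_(k < n) y k *: gauss_diag q n k) =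
             (\sum_(k < n) y k *: gauss_diag q n k) *m qderiv_mx q n.
  rewrite mulmx_sumr mulmx_suml; apply: eq_bigr => k _.
  by rewrite -scalemxAr -scalemxAl gauss_diag_comm.
split=> [comZ|[y ->]]; last exact: com.
exists (fun k => Z (Ordinal n_gt0) k); apply/eqP; rewrite -subr_eq0; apply/eqP.
apply: qderiv_mx_comm_row0 q_prim _ _.
  by rewrite mulmxBr mulmxBl comZ com.
move=> i j i0; have -> : i = Ordinal n_gt0 by apply: val_inj.
rewrite !mxE summxE (bigD1 j) //= !mxE /= eqxx gauss_binom0 !mulr1.
rewrite big1 ?addr0 ?subrr // => k ne_kj.
by rewrite !mxE add0n eq_sym val_eqE (negPf ne_kj) mul0r mulr0.
Qed.

(** The coefficients of x and x ^ 2 on both sides agree by the relations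
    T b - b T = (1 - q) a and T a = q a T. *)
Lemma qderiv_mx_pencil {R : comNzRingType} (q x : R) (n : nat)
    (a := diag_mx (\row_(i < n) q ^+ i))
    (b := \matrix_(i < n, j < n) (i == j.+1 :> nat)%:R) :
  q ^+ n = 1 ->
  (q * x *: a + b) *m (1%:M - x *: qderiv_mx q n) =
  (1%:M - x *: qderiv_mx q n) *m (x *: a + b).
Proof.
move=> qn1; set T := qderiv_mx q n.
have Ta : T *m a = q *: (a *m T).
  apply/matrixP => i j; rewrite mul_diag_mx mul_mx_diag !mxE.
  by case: eqP => [->|_]; rewrite ?exprS /=; ring.
have Tb : T *m b = b *m T + (1 - q) *: a.
  pose g i j : R := (i == j.+1)%:R.
  rewrite (mul_qderiv_mx _ _ g) // (mulr_qderiv_mx _ _ g).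
  apply/matrixP => i j; rewrite !mxE /g eqSS -val_eqE /=.
  case: j => [[|j] lt_jn] /=; last first.
    case: eqP => [->|_]; rewrite ?exprS /=; ring.
  case: eqP => [->|_]; rewrite ?expr0 ?expr1 /=; ring.
rewrite !(mulmxDl, mulmxDr, mulNmx, mulmxN, mulmx1, mul1mx).
rewrite -!scalemxAl -!scalemxAr Ta Tb.
by apply/matrixP => i j; rewrite !mxE; ring.
Qed.

(** * LU factorizations *)

(** Forward substitution: by induction on i, row i of X vanishes right of the
    diagonal. *)
Lemma trig_mx_div {F : fieldType} {n : nat} (L X : 'M[F]_n) :
  is_trig_mx L -> (forall i, L i i != 0) -> is_trig_mx (L *m X) ->
  is_trig_mx X.
Proof.
move=> /is_trig_mxP L0 Ld /is_trig_mxP LX0; apply/is_trig_mxP => i.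
have [m] := ubnP i; elim: m i => // m IHm i lt_im j lt_ij.
have := LX0 i j lt_ij; rewrite mxE (bigD1 i) //= big1 ?addr0 => [/eqP|k ne_ki].
  by rewrite mulf_eq0 (negPf (Ld i)) => /eqP.
have [lt_ik|le_ki] := ltnP i k; first by rewrite L0 ?mul0r.
have lt_ki : (k < i)%N by rewrite ltn_neqAle val_eqE ne_ki.
by rewrite IHm ?mulr0 //; [exact: leq_trans lt_ki _ | exact: ltn_trans lt_ij].
Qed.

Lemma trig_unitmx {F : fieldType} {n : nat} (L : 'M[F]_n) :
  is_trig_mx L -> (forall i, L i i != 0) -> L \in unitmx.
Proof.
by move=> L_trig Ld; rewrite unitmxE unitfE det_trig //; apply/prodf_neq0.
Qed.

(** X = U2 U1^-1 is lower triangular since L2 X = L1 is, and upper triangular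
    since X U1 = U2 is; its diagonal is that of U2 over that of U1. *)
Lemma LU_unique {F : fieldType} {n : nat} (L1 L2 U1 U2 : 'M[F]_n) :
  is_trig_mx L1 -> is_trig_mx L2 -> (forall i, L2 i i != 0) ->
  is_trig_mx U1^T -> (forall i, U1 i i = 1) ->
  is_trig_mx U2^T -> (forall i, U2 i i = 1) ->
  L1 *m U1 = L2 *m U2 -> U1 = U2.
Proof.
move=> L1t L2t L2d U1t U1d U2t U2d E.
have U1Td i : U1^T i i != 0 by rewrite mxE U1d oner_neq0.
have U1u : U1 \in unitmx by rewrite -unitmx_tr trig_unitmx.
pose X := U2 *m invmx U1.
have XU : X *m U1 = U2 by rewrite mulmxKV.
have Xt : is_trig_mx X.
  by apply: (trig_mx_div L2) => //; rewrite mulmxA -E mulmxK.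
have XTt : is_trig_mx X^T.
  by apply: (trig_mx_div U1^T) => //; rewrite -trmx_mul XU.
clearbody X; suff X1 : X = 1%:M by rewrite -XU X1 mul1mx.
have Xdiag i j : i != j -> X i j = 0.
  rewrite -val_eqE neq_ltn => /orP[lt_ij|lt_ji].
    exact: (is_trig_mxP Xt).
  by have := is_trig_mxP XTt _ _ lt_ji; rewrite mxE.
apply/matrixP => i j; rewrite [RHS]mxE.
have [<-|/Xdiag//] := eqVneq i j.
have := U2d i; rewrite -XU mxE (bigD1 i) //= big1 => [|k ne_ki].
  by rewrite addr0 U1d mulr1.
by rewrite Xdiag ?mul0r // eq_sym.
Qed.

(** Newton interpolation of the monomials at the nodes q ^ i; the powers of x
    come from writing x ^ j as x ^ k x ^ (j - k). *)
Lemma vandermonde_LU {R : comNzRingType} (q x : R) (n : nat) :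
  \matrix_(i < n, j < n) (q ^+ i * x) ^+ j =
  (\matrix_(i < n, j < n) (newton q j (q ^+ i) * x ^+ j)) *m gauss_mx q n x.
Proof.
apply/matrixP => i j; rewrite !mxE exprMn (expr_newton q (q ^+ i)) mulr_suml.
pose g k := newton q k (q ^+ i) * gauss_binom q j k * x ^+ j.
rewrite (big_ord_widen n g) // [RHS](bigID (fun k : 'I_n => (k < j.+1)%N)) /=.
rewrite [X in _ + X]big1 ?addr0 => [|k]; last first.
  by rewrite -leqNgt => lt_jk; rewrite !mxE gauss_binom_small ?mul0r ?mulr0.
apply: eq_bigr => k le_kj; rewrite !mxE /g.
have -> : x ^+ j = x ^+ k * x ^+ (j - k) by rewrite -exprD subnKC.
by ring.
Qed.

Lemma newton_root {R : comNzRingType} (q : R) (i j : nat) :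
  (i < j)%N -> newton q j (q ^+ i) = 0.
Proof.
by move=> lt_ij; rewrite /newton (bigD1 (Ordinal lt_ij)) //= subrr mul0r.
Qed.

Lemma newton_neq0 {R : idomainType} (q : R) (n i : nat) :
  n.-primitive_root q -> (i < n)%N -> newton q i (q ^+ i) != 0.
Proof.
move=> q_prim lt_in; apply/prodf_neq0 => l _.
rewrite subr_eq0 (eq_prim_root_expr q_prim) !modn_small //; last first.
  exact: ltn_trans lt_in.
by rewrite gtn_eqF.
Qed.

(** * Identification of alpha, the f_i and phi *)

Lemma GD_alphaX (R : realType) (n k : nat) :
  GD_alpha R n ^+ k =
  cos (2 * pi / n%:R * k%:R) +i* sin (2 * pi / n%:R * k%:R).
Proof.
elim: k => [|k IHk]; first by rewrite mulr0 cos0 sin0.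
have -> : 2 * pi / n%:R * k.+1%:R = 2 * pi / n%:R + 2 * pi / n%:R * k%:R :> R.
  by ring.
rewrite exprS IHk /GD_alpha cosD sinD.
by apply/eqP; rewrite eq_complex /= eqxx /=; apply/eqP; ring.
Qed.

(** With y = pi k / n one has Re (alpha ^ k) = 1 - 2 (sin y) ^ 2, which is less
    than 1 when 0 < k < n. *)
Lemma GD_alpha_prim (R : realType) (n : nat) :
  (0 < n)%N -> n.-primitive_root (GD_alpha R n).
Proof.
move=> n_gt0; have n_neq0 : n%:R != 0 :> R by rewrite pnatr_eq0 -lt0n.
have alpha_n : GD_alpha R n ^+ n = 1.
  by rewrite GD_alphaX divfK // mulr_natl cos2pi sin2pi.
apply/andP; split=> //; apply/forallP => i; rewrite unity_rootE.
have [->|ne_in] := eqVneq i.+1 n; first by rewrite alpha_n eqxx.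
have lt_in : (i.+1 < n)%N by rewrite ltn_neqAle ne_in ltn_ord.
have n_pos : (0 : R) < n%:R by rewrite ltr0n.
pose y : R := pi / n%:R * i.+1%:R.
have sin_y : 0 < sin y.
  apply: sin_gt0_pi; rewrite /y mulr_gt0 ?ltr0n ?divr_gt0 ?pi_gt0 //=.
  by rewrite mulrAC ltr_pdivrMr // ltr_pM2l ?pi_gt0 // ltr_nat.
apply/eqP/negbTE; rewrite GD_alphaX eq_complex /= negb_and; apply/orP; left.
have -> : 2 * pi / n%:R * i.+1%:R = y *+ 2 by rewrite /y mulr2n; ring.
rewrite cos_mulr2n cos2sin2 -subr_eq0.
have -> : (1 - sin y ^+ 2) *+ 2 - 1 - 1 = - (sin y ^+ 2 *+ 2) by ring.
by rewrite oppr_eq0 mulrn_eq0 sqrf_eq0 /= gt_eqF.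
Qed.

Lemma mx_pencil_gauss {R : realType} {n : nat} (x : R[i]) :
  mx_pencil (gauss_diag (GD_alpha R n) n) x = gauss_mx (GD_alpha R n) n x.
Proof.
apply/matrixP => i j; rewrite summxE !mxE.
have [lt_ji|le_ij] := ltnP j i.
  rewrite gauss_binom_small // mul0r big1 // => k _.
  by rewrite !mxE gauss_binom_small // !mulr0.
have lt_n : (j - i < n)%N by apply: leq_ltn_trans (leq_subr _ _) _.
rewrite (bigD1 (Ordinal lt_n)) //= big1 ?addr0 => [|k].
  by rewrite !mxE /= subnKC // eqxx mul1r mulrC.
rewrite -val_eqE /= !mxE => ne_k.
case: eqP => [Ej|]; last by rewrite mul0r mulr0.
by move: ne_k; rewrite Ej addKn eqxx.
Qed.

Lemma gauss_mx_trig {R : comNzRingType} (q x : R) (n : nat) :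
  is_trig_mx (gauss_mx q n x)^T.
Proof.
by apply/is_trig_mxP => i j lt_ij; rewrite !mxE gauss_binom_small ?mul0r.
Qed.

Lemma gauss_mx_diag {R : comNzRingType} (q x : R) (n : nat) (i : 'I_n) :
  gauss_mx q n x i i = 1.
Proof. by rewrite mxE gauss_binomnn subnn mulr1. Qed.

Lemma gauss_mx_unit {F : fieldType} (q x : F) (n : nat) :
  gauss_mx q n x \in unitmx.
Proof.
rewrite -unitmx_tr trig_unitmx ?gauss_mx_trig // => i.
by rewrite mxE gauss_mx_diag oner_neq0.
Qed.

Lemma newton_mx_trig {R : comNzRingType} (q x : R) (n : nat) :
  is_trig_mx (\matrix_(i < n, j < n) (newton q j (q ^+ i) * x ^+ j)).
Proof.
by apply/is_trig_mxP => i j lt_ij; rewrite mxE newton_root ?mul0r.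
Qed.

Lemma gauss_diag_factorization (R : realType) (n : nat) :
  GD_factorization (gauss_diag (GD_alpha R n) n).
Proof.
set q := GD_alpha R n; split=> [i i0|].
  apply/matrixP => j k; rewrite !mxE i0 addn0 eq_sym val_eqE.
  by have [->|] := eqVneq j k; rewrite ?gauss_binomnn ?mul1r ?mul0r.
exists (fun x => \matrix_(i < n, j < n) (newton q j (q ^+ i) * x ^+ j)) => x.
rewrite mx_pencil_gauss; split; first exact: newton_mx_trig.
  by split; [exact: gauss_mx_trig | exact: gauss_mx_diag].
exact: vandermonde_LU.
Qed.

(** The hypothesis x <> 0 makes V(x), hence its lower factor, invertible. *)
Lemma GD_factorization_pencil (R : realType) (n : nat) (f : 'I_n -> 'M[R[i]]_n)
    (x : R[i]) :
  (0 < n)%N -> x != 0 -> GD_factorization f ->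
  mx_pencil f x = gauss_mx (GD_alpha R n) n x.
Proof.
move=> n_gt0 x_neq0 [_ [phim /(_ x)[phim_trig [f_trig f_diag] Vf]]].
have q_prim := GD_alpha_prim R n n_gt0.
apply: LU_unique phim_trig (newton_mx_trig (GD_alpha R n) x n) _ f_trig f_diag
  (gauss_mx_trig _ x n) (gauss_mx_diag _ x n) _.
  by move=> i; rewrite mxE mulf_neq0 ?expf_neq0 ?(newton_neq0 _ n) //.
by rewrite -Vf -vandermonde_LU.
Qed.

(** Each entry of the pencils is a polynomial of degree < n, and the n distinct
    powers of alpha are enough nonzero points to determine it. *)
Lemma mx_pencil_inj (R : realType) (n : nat) (f g : 'I_n -> 'M[R[i]]_n) :
  (0 < n)%N -> (forall x, x != 0 -> mx_pencil f x = mx_pencil g x) -> f = g.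
Proof.
move=> n_gt0 eq_fg; have q_prim := GD_alpha_prim R n n_gt0.
apply/funext => k; apply/matrixP => i j.
pose p := \poly_(k < n) (if insub k is Some l then f l i j - g l i j else 0).
have p0 : p = 0.
  apply: (@roots_geq_poly_eq0 _ _ [seq GD_alpha R n ^+ l | l <- iota 0 n]).
  - apply/allP => _ /mapP[l _ ->].
    have /eq_fg/matrixP/(_ i j) : GD_alpha R n ^+ l != 0.
      by rewrite expf_neq0 // (prim_root_eq0 q_prim) -lt0n.
    rewrite !summxE => /eqP; rewrite -subr_eq0 -sumrB => /eqP E.
    apply/rootP; rewrite horner_poly -[RHS]E; apply: eq_bigr => m _.
    by rewrite valK !mxE; ring.
  - rewrite map_inj_in_uniq ?iota_uniq // => l m.
    rewrite !mem_iota /= => ltl ltm.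
    by move=> /eqP; rewrite (eq_prim_root_expr q_prim) !modn_small // => /eqP.
  - by rewrite size_map size_iota size_poly.
have := congr1 (fun r : {poly _} => r`_k) p0.
by rewrite coef_poly ltn_ord valK coef0 => /eqP; rewrite subr_eq0 => /eqP.
Qed.

Lemma GD_fE (R : realType) (n : nat) :
  (0 < n)%N -> @GD_f R n = gauss_diag (GD_alpha R n) n.
Proof.
move=> n_gt0; apply: xget_unique; first exact: gauss_diag_factorization.
move=> f f_fact; apply: mx_pencil_inj => // x x_neq0.
by rewrite mx_pencil_gauss; apply: GD_factorization_pencil.
Qed.

Lemma GD_reality_intertwine (R : realType) (n : nat) (A : R[i] -> 'M[R[i]]_n) :
  (0 < n)%N ->
  GD_reality A <->
  forall x, A (GD_alpha R n * x) *m (1%:M - x *: qderiv_mx (GD_alpha R n) n) =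
            (1%:M - x *: qderiv_mx (GD_alpha R n) n) *m A x.
Proof.
move=> n_gt0; set q := GD_alpha R n; set T := qderiv_mx q n.
have phiE x : GD_phi n x = gauss_mx q n x.
  by rewrite /GD_phi GD_fE ?mx_pencil_gauss.
have qn1 : q ^+ n = 1 := prim_expr_order (GD_alpha_prim R n n_gt0).
have phi_unit x := gauss_mx_unit q x n.
have phi_scale x := gauss_mx_scale q n x qn1.
split=> H x; have := H x; rewrite !phiE -/q => E.
  (* Conjugation by phi(q x) and phi(x) is undone by multiplying by phi(q x) on
     the left and by phi(x)^-1 on the right. *)
  have /= := congr1
    (fun M => gauss_mx q n (q * x) *m M *m invmx (gauss_mx q n x)) E.
  rewrite !mulmxA mulmxV // mul1mx mulmxK // phi_scale.
  by rewrite !mulmxA !mulmxK.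
apply: (can_inj (mulKmx (phi_unit (q * x)))).
by rewrite !mulmxA mulmxV // mul1mx phi_scale !mulmxA mulmxK // E.
Qed.

Theorem mainTheorem18 (R : realType) (n : nat) (n_gt0 : (0 < n)%N)
    (Y : 'M[R[i]]_n) :
  GD_reality (fun lambda : R[i] => lambda *: GD_a R n + Y) <->
  exists y : 'I_n -> R[i], Y = GD_b R n + \sum_(i < n) y i *: @GD_f R n i.
Proof.
set q := GD_alpha R n; set T := qderiv_mx q n.
have q_prim : n.-primitive_root q := GD_alpha_prim R n n_gt0.
have pencil x : (q * x *: GD_a R n + GD_b R n) *m (1%:M - x *: T) =
    (1%:M - x *: T) *m (x *: GD_a R n + GD_b R n).
  exact: qderiv_mx_pencil (prim_expr_order q_prim).
rewrite GD_reality_intertwine // GD_fE // -/q -/T.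
have [Z YE] : exists Z, Y = GD_b R n + Z.
  by exists (Y - GD_b R n); rewrite addrC subrK.
transitivity (T *m Z = Z *m T); last first.
  rewrite qderiv_mx_commutant //; split=> -[y Ey]; exists y.
    by rewrite YE Ey.
  by apply: (addrI (GD_b R n)); rewrite -YE.
have step x : (q * x *: GD_a R n + Y) *m (1%:M - x *: T) =
    (1%:M - x *: T) *m (x *: GD_a R n + Y) <-> x *: (Z *m T) = x *: (T *m Z).
  rewrite YE !addrA [LHS]mulmxDl [RHS]mulmxDr pencil.
  rewrite [Z *m (_ - _)]mulmxBr [(_ - _) *m Z]mulmxBl mulmx1 mul1mx.
  rewrite -scalemxAl -scalemxAr.
  split=> [/addrI E|->//].
  by apply: oppr_inj; apply: (addrI Z).
split=> [/(_ 1)/step|comZ x]; first by rewrite !scale1r.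
by apply/step; rewrite comZ.
Qed.
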